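(* For $\alpha\in\mathbf l[n]$ define $$\chi_\alpha(t)=\sum_{a\models n}c_a(\alpha)\binom{t}{\ell(a)},$$ where the sum is over integer compositions $a=(a_1,\dots,a_\ell)$ of $n$, $\ell(a)=\ell$, and $c_a(\alpha)$ is the number of set compositions $A=(A_1,\dots,A_\ell)$ of $[n]$ with $|A_i|=a_i$ and $\alpha|_{A_i}$ increasing for all $i$. Then for every positive integer $t$, $\chi_\alpha(t)$ counts the number of ways to color the entries of $\alpha$ with at most $t$ distinct colors (maps $f:[n]\to[t]$) so that the restriction of $\alpha$ to each color class is increasing. Moreover $$\chi_\alpha(-1)=(-1)^n d_{\alpha,\epsilon},$$ where $d_{\alpha,\epsilon}$ is the number of $\beta=\beta_1\cdots\beta_n\in\mathbf l[n]$ such that for every $1\le i<n$, $\beta_i>\beta_{i+1}$ or $\alpha^{-1}(\beta_i)>\alpha^{-1}(\beta_{i+1})$.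
   Context: $\mathbf l[n]$ is the set of words $\alpha=\alpha_1\cdots\alpha_n$ that are linear orders (permutations) of $[n]=\{1,\dots,n\}$, and $\epsilon=12\cdots n$. $\alpha|_S$ is the subword of $\alpha$ consisting of the letters in $S$; it is increasing if its letters appear in increasing numerical order. $\alpha^{-1}(j)$ is the position of $j$ in $\alpha$. A set composition of $[n]$ is a sequence of nonempty pairwise disjoint subsets with union $[n]$. *)

(* Defs.v *)
From mathcomp Require Import all_boot all_order all_algebra all_fingroup.

Set Implicit Arguments.
Unset Strict Implicit.
Unset Printing Implicit Defensive.

Import GRing.Theory Num.Theory.

(* Letters and positions 1,...,n are shifted to 'I_n = {0,...,n-1}. A linear
   order alpha_1...alpha_n is the permutation sending a position to the letter
   at that position, so alpha^-1 sends a letter to its position. *)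

Definition word n (alpha : 'S_n) : seq 'I_n := [seq alpha i | i <- enum 'I_n].

Definition subword n (alpha : 'S_n) (S : {set 'I_n}) : seq 'I_n :=
  [seq x <- word alpha | x \in S].

Definition increasing n (w : seq 'I_n) : bool :=
  sorted (fun x y : 'I_n => x < y) w.

Definition composition (n : nat) (a : seq nat) : bool :=
  (0 \notin a) && (sumn a == n).

Definition set_composition (T : finType) (A : seq {set T}) : bool :=
  [&& set0 \notin A, pairwise (fun B C : {set T} => [disjoint B & C]) A
    & \bigcup_(B <- A) B == [set: T]].

Definition comp_coef n (alpha : 'S_n) (a : seq nat) : nat :=
  #|[set A : (size a).-tuple {set 'I_n} |
      [&& set_composition A,
          [seq #|B| | B : {set 'I_n} <- A] == a
        & all (fun B => increasing (subword alpha B)) A]]|.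

(* The polynomial t (t - 1) ... (t - k + 1) / k!. *)
Definition binomial_poly (k : nat) : {poly rat} :=
  ((k`!)%:R^-1 *: \prod_(i < k) ('X - (i%:R)%:P))%R.

(* Compositions of n have at most n parts, each at most n, so each occurs in
   n.-bseq 'I_n.+1, exactly once: see parts_inj and composition_bseq below. *)
Definition parts n (a : n.-bseq 'I_n.+1) : seq nat := [seq val x | x <- a].

Definition chi n (alpha : 'S_n) : {poly rat} :=
  (\sum_(a : n.-bseq 'I_n.+1 | composition n (parts a))
     (comp_coef alpha (parts a))%:R *: binomial_poly (size (parts a)))%R.

Definition colorings n (alpha : 'S_n) (t : nat) : {set {ffun 'I_n -> 'I_t}} :=
  [set f : {ffun 'I_n -> 'I_t} |
    [forall c : 'I_t, increasing (subword alpha (f @^-1: [set c]))]].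

(* d_{alpha,epsilon}; consecutive positions are pairs i, j with j = i + 1. *)
Definition dcoef n (alpha : 'S_n) : nat :=
  #|[set beta : 'S_n |
      [forall i : 'I_n, forall j : 'I_n, (val j == (val i).+1) ==>
        ((beta i > beta j) || ((alpha^-1)%g (beta i) > (alpha^-1)%g (beta j)))]]|.

Lemma parts_inj n : injective (@parts n).
Proof. by move=> a b /(inj_map val_inj) /val_inj. Qed.

Lemma composition_bseq n (s : seq nat) :
  composition n s -> exists a : n.-bseq 'I_n.+1, parts a = s.
Proof.
case/andP=> s0 /eqP sn.
have le_s x : x \in s -> x <= n.
  rewrite -sn; elim: s {s0 sn} => //= y s IH; rewrite inE => /orP[/eqP->|/IH].
    exact: leq_addr.
  by move=> h; apply: leq_trans h (leq_addl _ _).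
have sz : size s <= n.
  rewrite -sn; elim: s s0 {sn le_s} => //= y s IH; rewrite inE negb_or.
  by case: y => //= y /IH h; rewrite addSn ltnS (leq_trans h) // leq_addl.
have sz' : size [seq inord x : 'I_n.+1 | x <- s] <= n by rewrite size_map.
exists (Bseq sz'); rewrite /parts /= -map_comp -[RHS]map_id.
by apply/eq_in_map => x /le_s h /=; rewrite inordK.
Qed.

Lemma binomial_polyE (k t : nat) : (binomial_poly k).[t%:R]%R = ('C(t, k))%:R%R.
Proof.
have k0 : (k`!%:R : rat)%R != 0%R by rewrite pnatr_eq0 -lt0n fact_gt0.
apply: (mulfI k0); rewrite hornerZ mulrA divff // mul1r -natrM mulnC bin_ffact.
elim: k {k0} => [|k IH]; first by rewrite big_ord0 hornerC ffactn0.
rewrite big_ord_recr hornerM IH hornerXsubC ffactnSr natrM.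
have [le_kt | lt_tk] := leqP k t; first by rewrite natrB.
by rewrite ffact_small // !mul0r.
Qed.

(* Main.v *)
Require Import Defs.
From mathcomp Require Import all_boot all_order all_algebra all_fingroup.

Set Implicit Arguments.
Unset Strict Implicit.
Unset Printing Implicit Defensive.

Import GRing.Theory Num.Theory.

(** Order the letters by x < y iff x precedes y both numerically and in alpha;
a block A_i is admissible iff it is a chain of this partial order. Writing the
chains one after the other, admissible set compositions with block sizes a
correspond to words beta all of whose pieces, cut according to a, are
increasing chains. Since the binomial of -1 and k is (-1)^k, chi(-1) is a sum
over beta of the signed number of ways to cut beta into chains. A cut between
two consecutive letters is optional exactly when they form an ascent, so the
signs cancel unless beta has no ascent, which is the condition defining
d_{alpha,epsilon}. For t > 0, a coloring is a choice of the set of colors used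
together with the set composition formed by its classes in color order. *)

(** * Compositions of an integer and signed sums over them *)

(** The recursion follows the removal of the first letter of a word: that letter is a piece by
    itself or belongs to a longer first piece. The inner match excludes [m = 0], where [incr_nth
    [::] 0] would list [[:: 1]] a second time. *)
Fixpoint compositions (n : nat) : seq (seq nat) :=
  if n is m.+1 then
    [seq 1 :: a | a <- compositions m] ++
    (if m is _.+1 then [seq incr_nth a 0 | a <- compositions m] else [::])
  else [:: [::]].

Lemma mem_compositions n a : (a \in compositions n) = composition n a.
Proof.
elim: n a => [|n IHn] a.
  case: a => [|k a] //=.
  by rewrite inE /composition inE /= addn_eq0; case: k => //=; rewrite andbF.
rewrite /= mem_cat.
have -> : (a \in [seq 1 :: a0 | a0 <- compositions n])
          = (head 0 a == 1) && composition n (behead a).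
  apply/mapP/andP => [[b + ->]|]; first by rewrite IHn.
  by case: a => [|k a] [/eqP] //= -> h; exists a; rewrite ?IHn.
case: n IHn => [|n] IHn.
  case: a => [|k a] //=; rewrite in_nil orbF /composition !inE /= negb_or.
  case: k => [|[|k]] //=; rewrite ?addSn ?add0n ?eqSS //.
  by rewrite andbF.
have -> : (a \in [seq incr_nth a0 0 | a0 <- compositions n.+1])
          = (head 0 a > 1) && composition n.+1 ((head 0 a).-1 :: behead a).
  apply/mapP/andP => [[[|k b]]|].
  - by rewrite IHn.
  - rewrite IHn /= => h ->; split => //=; case: k h => //.
  by case: a => [|[|[|k]] a] [] //= _ h; exists (k.+1 :: a); rewrite ?IHn.
case: a => [|[|[|k]] a] //=; rewrite ?orbF /composition !inE //=.
Qed.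

Lemma compositionsSS n :
  compositions n.+2 =
  [seq 1 :: a | a <- compositions n.+1] ++
  [seq incr_nth a 0 | a <- compositions n.+1].
Proof. by []. Qed.

Arguments compositions : simpl never.

Lemma uniq_compositions n : uniq (compositions n).
Proof.
elim: n => [|[|n] IHn] //.
rewrite compositionsSS cat_uniq map_inj_uniq ?IHn; last by move=> ? ? [].
apply/and3P; split=> //.
  (* An entry common to both halves would have first part [k.+1 = 1], hence a zero part [k]. *)
  apply/hasPn => _ /mapP[[|k a] + ->]; rewrite mem_compositions //.
  case/andP=> k0 _; apply/mapP => -[b _ [E _]].
  by rewrite E inE in k0.
rewrite map_inj_in_uniq // => -[|k a] [|l b]; rewrite !mem_compositions //.
by move=> _ _ /= [-> ->].
Qed.

(** Moves the sum defining [chi] to a list on which one can argue by induction. *)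
Lemma big_compositions (R : nmodType) n (F : seq nat -> R) :
  (\sum_(a : n.-bseq 'I_n.+1 | composition n (parts a)) F (parts a) =
   \sum_(a <- compositions n) F a)%R.
Proof.
rewrite -big_filter -(big_map (@parts n) predT F); apply: perm_big.
apply: uniq_perm; first 2 last.
- move=> a; rewrite mem_compositions; apply/mapP/idP => [[b + ->]|ca].
    by rewrite mem_filter => /andP[].
  have [b Eb] := composition_bseq ca.
  by exists b => //; rewrite mem_filter Eb ca mem_index_enum.
- by rewrite (map_inj_uniq (@parts_inj n)) filter_uniq ?index_enum_uniq.
- exact: uniq_compositions.
Qed.

(** Induction on [w]: cutting between the first two letters [x] and [y] gives minus the sum for the
    tail, and not cutting gives [r x y] times that same sum. The two cancel when [r x y] holds, and
    only the first survives otherwise. *)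
Lemma signed_sorted_reshape (T : Type) (r : rel T) (w : seq T) :
  (\sum_(a <- compositions (size w))
     (-1) ^+ size a * (all (sorted r) (reshape a w))%:R =
   (-1) ^+ size w * (sorted (fun x y => ~~ r x y) w)%:R :> rat)%R.
Proof.
elim: w => [|x [|y w] IHw]; rewrite ?big_seq1 //.
rewrite [size _]/= compositionsSS big_cat !big_map -/(size (y :: w)).
rewrite [LHS]/=.
set S := (X in (X + _)%R).
have {S}-> : S = (- \sum_(a <- compositions (size (y :: w)))
    (-1) ^+ size a * (all (sorted r) (reshape a (y :: w)))%:R)%R.
  rewrite -sumrN; apply: eq_bigr => a _.
  by rewrite exprS mulN1r mulNr.
set S := (X in (_ + X)%R).
have {S}-> : S = ((r x y)%:R * \sum_(a <- compositions (size (y :: w)))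
    (-1) ^+ size a * (all (sorted r) (reshape a (y :: w)))%:R)%R.
  (* The first part is positive, so [y] lies in the first piece; putting [x] in front of it adds
     only the condition [r x y]. *)
  rewrite mulr_sumr; apply: eq_big_seq => -[|[|k] a];
    rewrite mem_compositions // => _.
  by rewrite mulrCA -natrM mulnb /= andbA.
rewrite {}IHw exprS /=; case: (r x y) => /=.
  by rewrite mul1r addNr mulr0.
by rewrite mul0r addr0 mulN1r mulNr.
Qed.

(** * Set compositions as lists of lists *)

Lemma uniq_flatten_disjoint (T : finType) (ss : seq (seq T)) :
  uniq (flatten ss) =
  all uniq ss && pairwise (fun B C : {set T} => [disjoint B & C])
                   [seq [set x in s] | s <- ss].
Proof.
elim: ss => //= s ss IHss; rewrite cat_uniq {}IHss all_map.
have -> : ~~ has (mem s) (flatten ss) =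
    all (preim (fun s : seq T => [set x in s])
               (fun C : {set T} => [disjoint [set x in s] & C])) ss.
  apply/hasPn/allP => /= [H u uss | H x /flattenP[u uss xu]].
    rewrite disjoint_sym; apply/pred0P => x /=; rewrite !inE.
    by apply/negP => /andP[xu]; apply/negP/H/flattenP; exists u.
  by have /pred0P/(_ x) := H u uss; rewrite /= !inE xu andbT => ->.
by rewrite -!andbA; congr (_ && _); rewrite andbCA.
Qed.

Lemma bigcup_seq_flatten (T : finType) (ss : seq (seq T)) :
  \bigcup_(B <- [seq [set x in s] | s <- ss]) B = [set x in flatten ss].
Proof.
elim: ss => [|s ss IHss]; first by rewrite big_nil; apply/setP => x; rewrite !inE.
by rewrite /= big_cons IHss; apply/setP => x; rewrite !inE mem_cat.
Qed.

Lemma set_composition_flatten (T : finType) (ss : seq (seq T)) :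
  all uniq ss ->
  set_composition [seq [set x in s] | s <- ss] =
  [&& [::] \notin ss, uniq (flatten ss) & [set x in flatten ss] == setT].
Proof.
move=> uss; rewrite /set_composition bigcup_seq_flatten uniq_flatten_disjoint uss.
congr (~~ _ && _); apply/mapP/idP => [[s sss /esym E]|]; last first.
  by exists [::] => //; apply/setP => x; rewrite !inE.
suff <- : s = [::] by [].
by case: s {sss} E => // y s /setP/(_ y); rewrite !inE eqxx.
Qed.

(** * Words, chains and the coefficients of [chi] *)

Section Words.
Variables (n : nat) (alpha : 'S_n).
Implicit Types (beta : 'S_n) (B : {set 'I_n}) (w : seq 'I_n) (a : seq nat).

Lemma size_word beta : size (word beta) = n.
Proof. by rewrite size_map size_enum_ord. Qed.

Lemma uniq_word beta : uniq (word beta).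
Proof. by rewrite map_inj_uniq ?enum_uniq //; apply: perm_inj. Qed.

Lemma mem_word beta x : x \in word beta.
Proof. by apply/mapP; exists ((beta^-1)%g x); rewrite ?mem_enum ?permKV. Qed.

Lemma nth_word x0 beta (i : 'I_n) : nth x0 (word beta) i = beta i.
Proof. by rewrite (nth_map i) ?nth_ord_enum // size_enum_ord. Qed.

Lemma word_inj : injective (@word n).
Proof.
by move=> b1 b2 E; apply/permP => i; rewrite -!(nth_word i) E.
Qed.

Lemma wordP w : uniq w -> size w = n -> exists beta, word beta = w.
Proof.
move=> uw /eqP sw; pose t := Tuple sw.
have t_inj : injective (tnth t) by apply/tuple_uniqP.
exists (perm t_inj); rewrite -[RHS](map_tnth_enum t).
by apply: eq_map => i; rewrite permE.
Qed.

Definition chain_rel : rel 'I_n :=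
  [rel x y : 'I_n | (x < y) && ((alpha^-1)%g x < (alpha^-1)%g y)].

Lemma mem_subword B : subword alpha B =i B.
Proof. by move=> x; rewrite mem_filter mem_word andbT. Qed.

Lemma set_subword B : [set x in subword alpha B] = B.
Proof. by apply/setP => x; rewrite inE mem_subword. Qed.

Lemma uniq_subword B : uniq (subword alpha B).
Proof. exact/filter_uniq/uniq_word. Qed.

Lemma size_subword B : size (subword alpha B) = #|B|.
Proof. by rewrite -(card_uniqP (uniq_subword B)); apply/eq_card/mem_subword. Qed.

Lemma subword_sorted B :
  sorted [rel x y : 'I_n | (alpha^-1)%g x < (alpha^-1)%g y] (subword alpha B).
Proof.
apply: sorted_filter => [y x z|]; first exact: ltn_trans.
rewrite /word sorted_map (eq_sorted (e' := relpre val ltn)); last first.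
  by move=> i j; rewrite /= !permK.
by rewrite -sorted_map val_enum_ord iota_ltn_sorted.
Qed.

Lemma increasing_subwordE B :
  increasing (subword alpha B) = sorted chain_rel (subword alpha B).
Proof. by rewrite sorted_relI subword_sorted andbT. Qed.

(** Both lists have the same letters and are strictly sorted by position in [alpha], so they
    coincide: a chain is recovered from its underlying set. *)
Lemma sorted_subword w : sorted chain_rel w -> subword alpha [set x in w] = w.
Proof.
rewrite sorted_relI => /andP[_ sw].
apply: (irr_sorted_eq (leT := [rel x y : 'I_n | (alpha^-1)%g x < (alpha^-1)%g y])).
- by move=> y x z; apply: ltn_trans.
- by move=> x; rewrite /= ltnn.
- exact: subword_sorted.
- exact: sw.
- by move=> x; rewrite mem_subword inE.
Qed.

(* Listing each block in the order of alpha and concatenating turns an ordered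
   set partition into chains of sizes a into a word cut into pieces of sizes a. *)
Lemma comp_coefE a : composition n a ->
  comp_coef alpha a =
  #|[set beta : 'S_n | all (sorted chain_rel) (reshape a (word beta))]|.
Proof.
case/andP=> a0 /eqP an.
have szP w : size [seq [set x in s] | s <- reshape a w] == size a.
  by rewrite size_map size_reshape.
pose f beta : (size a).-tuple {set 'I_n} := Tuple (szP (word beta)).
have flatK beta : flatten (reshape a (word beta)) = word beta.
  by rewrite reshapeKr // size_word an.
have shapeK beta : shape (reshape a (word beta)) = a.
  by rewrite reshapeKl // size_word an.
have subK beta : all (sorted chain_rel) (reshape a (word beta)) ->
    map (subword alpha) (f beta) = reshape a (word beta).
  move=> /allP H; rewrite /= -map_comp -[RHS]map_id.
  by apply/eq_in_map => s /H; apply: sorted_subword.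
(* Injectivity: [subword alpha] recovers the pieces from the blocks, and flattening the pieces
   recovers the word. *)
rewrite -[RHS](card_in_imset (f := f)); last first.
  move=> b1 b2; rewrite !inE => /subK E1 /subK E2 E.
  by apply: word_inj; rewrite -[LHS]flatK -[RHS]flatK -E1 -E2 E.
apply: eq_card => A; rewrite inE; apply/and3P/imsetP.
  (* Surjectivity: the preimage of [A] is the word obtained by concatenating the subwords of its
     blocks. *)
  case=> cA /eqP sA iA; pose ss := map (subword alpha) A.
  have EA : [seq [set x in s] | s <- ss] = A.
    by rewrite -map_comp map_id_in // => B _; apply: set_subword.
  have uss : all uniq ss by apply/allP => _ /mapP[B _ ->]; apply: uniq_subword.
  move: cA; rewrite -{1}EA set_composition_flatten // => /and3P[_ uf _].
  have sh : shape ss = a.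
    by rewrite -sA /shape -map_comp; apply: eq_map => B; apply: size_subword.
  have szf : size (flatten ss) = n by rewrite size_flatten sh.
  have [beta Eb] := wordP uf szf.
  have Er : reshape a (word beta) = ss by rewrite Eb -sh flattenK.
  exists beta; last by apply: val_inj; rewrite /= Er EA.
  rewrite inE Er; apply/allP => _ /mapP[B AB ->].
  by rewrite -increasing_subwordE; apply: (allP iA).
case=> beta; rewrite inE => sb ->.
have uf : uniq (flatten (reshape a (word beta))) by rewrite flatK uniq_word.
have uss : all uniq (reshape a (word beta)).
  by move: uf; rewrite uniq_flatten_disjoint => /andP[].
split.
- rewrite set_composition_flatten // uf; apply/and3P; split=> //.
    apply/negP => nil_ss; case/negP: a0; rewrite -(shapeK beta).
    by apply/mapP; exists [::].
  by rewrite flatK; apply/eqP/setP => x; rewrite !inE mem_word.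
- rewrite -[X in _ == X](shapeK beta) /= -map_comp; apply/eqP.
  apply/eq_in_map => s /(allP uss) us /=.
  by rewrite cardsE; apply/card_uniqP.
- apply/allP => B /mapP[s ss_s ->].
  rewrite increasing_subwordE sorted_subword; exact: (allP sb).
Qed.

Lemma dcoefE :
  dcoef alpha =
  #|[set beta : 'S_n | sorted (fun x y => ~~ chain_rel x y) (word beta)]|.
Proof.
apply: eq_card => beta; rewrite !inE.
(* Negating [chain_rel] yields weak inequalities; they are strict because distinct positions of
   [beta] carry distinct letters, which occupy distinct positions of [alpha]. *)
have E (i j : 'I_n) : i != j ->
    ~~ chain_rel (beta i) (beta j) =
    (beta i > beta j) || ((alpha^-1)%g (beta i) > (alpha^-1)%g (beta j)).
  move=> ij; rewrite /chain_rel /= negb_and -!leqNgt !ltn_neqAle.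
  have -> : val (beta j) != beta i.
    by rewrite (inj_eq val_inj) (inj_eq perm_inj) eq_sym.
  have -> // : val ((alpha^-1)%g (beta j)) != (alpha^-1)%g (beta i).
  by rewrite (inj_eq val_inj) !(inj_eq perm_inj) eq_sym.
have neqS (i j : 'I_n) : val j == (val i).+1 -> i != j.
  by apply: contraTneq => ->; rewrite neq_ltn ltnSn.
apply/forallP/idP => [H | Hs i].
  case Ew: (word beta) => [|x0 w] //; rewrite -Ew {w Ew}.
  apply/(sortedP x0) => i; rewrite size_word => lt_i1n.
  have lt_in := ltnW lt_i1n; pose j := Ordinal lt_i1n; pose k := Ordinal lt_in.
  have := forallP (H k) j; rewrite /= eqxx /= -E; last exact: neqS.
  by rewrite -(nth_word x0 beta j) -(nth_word x0 beta k).
apply/forallP => j; apply/implyP => /[dup] /eqP Ej /neqS ij; rewrite -E //.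
have := sortedP i Hs i; rewrite size_word -Ej ltn_ord => /(_ isT).
by rewrite (nth_word i beta i) (nth_word i beta j).
Qed.

(** * Evaluation at -1 *)

(** The factors [-1 - i] for [i < k] multiply to [(-1) ^+ k * k!]. *)
Lemma binomial_polyN1 k : ((binomial_poly k).[-1] = (-1) ^+ k)%R.
Proof.
have k0 : (k`!%:R : rat)%R != 0%R by rewrite pnatr_eq0 -lt0n fact_gt0.
apply: (mulfI k0); rewrite hornerZ mulrA divff // mul1r.
elim: k {k0} => [|k IHk]; first by rewrite big_ord0 hornerC mulr1.
rewrite big_ord_recr hornerM IHk hornerXsubC factS natrM exprS.
rewrite -opprD -[(1 + _)%R]/(1%:R + _)%R -natrD add1n mulrN mulN1r mulrN.
by rewrite mulrAC -mulrA mulrCA mulrA.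
Qed.

Lemma chiE x :
  (chi alpha).[x]%R =
  (\sum_(a <- compositions n)
     (comp_coef alpha a)%:R * (binomial_poly (size a)).[x])%R.
Proof.
rewrite -(big_compositions n
  (fun a => (comp_coef alpha a)%:R * (binomial_poly (size a)).[x])%R).
by rewrite horner_sum; apply: eq_bigr => a _; rewrite hornerZ.
Qed.

Lemma chiN1 : ((chi alpha).[-1] = (-1) ^+ n * (dcoef alpha)%:R)%R.
Proof.
have natr_card (p : pred 'S_n) :
    (#|[set beta | p beta]|%:R = \sum_beta (p beta)%:R :> rat)%R.
  rewrite -sum1_card natr_sum big_mkcond; apply: eq_bigr => beta _.
  by rewrite inE; case: (p beta).
rewrite chiE dcoefE natr_card mulr_sumr.
under eq_big_seq => a.
  rewrite mem_compositions => ca.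
  rewrite binomial_polyN1 comp_coefE // natr_card mulr_suml.
  over.
rewrite exchange_big; apply: eq_bigr => beta _.
have := signed_sorted_reshape chain_rel (word beta); rewrite size_word => <-.
by apply: eq_bigr => a _; rewrite mulrC.
Qed.

(** * Colorings and evaluation at positive integers *)

(** Only colors in the image are listed, in increasing order, so that no size is zero. *)
Definition class_sizes t (f : {ffun 'I_n -> 'I_t}) : seq nat :=
  [seq #|f @^-1: [set c]| | c <- enum (f @: setT)].

Lemma set_composition_classes t (f : {ffun 'I_n -> 'I_t}) :
  set_composition [seq f @^-1: [set c] | c <- enum (f @: setT)].
Proof.
apply/and3P; split.
- apply/mapP => -[c]; rewrite mem_enum => /imsetP[x _ ->] /setP/(_ x).
  by rewrite !inE eqxx.
- rewrite pairwise_map; have := enum_uniq (f @: setT); rewrite uniq_pairwise.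
  apply: sub_pairwise => c d /= cd; apply/pred0P => x /=; rewrite !inE.
  by apply/negP => /andP[/eqP->]; apply/negP.
- apply/eqP/setP => x; rewrite big_map inE big_enum; apply/bigcupP.
  by exists (f x); rewrite ?imset_f // !inE.
Qed.

Lemma composition_class_sizes t (f : {ffun 'I_n -> 'I_t}) :
  composition n (class_sizes f).
Proof.
apply/andP; split.
  apply/mapP => -[c]; rewrite mem_enum => /imsetP[x _ ->] /esym/eqP.
  by rewrite cards_eq0 => /eqP/setP/(_ x); rewrite !inE eqxx.
rewrite sumnE big_map big_enum; apply/eqP.
under eq_bigr do rewrite -sum1_card.
rewrite -[RHS]card_ord -[in RHS]sum1_card.
rewrite [RHS](partition_big f (mem (f @: setT))) /=; last first.
  by move=> x _; apply: imset_f.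
by apply: eq_bigr => c _; apply: eq_bigl => x; rewrite !inE.
Qed.

(** A coloring corresponds to a pair: its tuple of nonempty classes in color order, and its set of
    used colors, of cardinality [size a]. *)
Lemma card_colorings_sizes t a : 0 < t ->
  #|[set f in colorings alpha t | class_sizes f == a]| =
  comp_coef alpha a * 'C(t, size a).
Proof.
move=> t0.
rewrite -[in 'C(t, _)](card_ord t) -card_draws /comp_coef -cardsX.
(* The default tuple of empty sets is not reached when [class_sizes f == a], since the list then has
   length [size a]. *)
pose classes (f : {ffun 'I_n -> 'I_t}) : (size a).-tuple {set 'I_n} :=
  insubd (nseq_tuple _ set0) [seq f @^-1: [set c] | c <- enum (f @: setT)].
have size_im (f : {ffun 'I_n -> 'I_t}) : class_sizes f == a ->
    #|f @: setT| = size a.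
  by move/eqP <-; rewrite size_map -cardE.
have val_classes f : class_sizes f == a ->
    classes f = [seq f @^-1: [set c] | c <- enum (f @: setT)] :> seq _.
  by move=> /size_im fa; rewrite val_insubd size_map -cardE fa eqxx.
rewrite -[LHS](card_in_imset (f := fun f => (classes f, f @: setT))).
  apply: eq_card => -[A S]; rewrite !inE /=; apply/imsetP/andP.
    case=> f; rewrite !inE => /andP[/forallP fc fa] [-> ->].
    split; last by rewrite size_im.
    rewrite val_classes // set_composition_classes -map_comp fa /=.
    by apply/allP => _ /mapP[c _ ->].
  case=> /and3P[cA sA iA] /eqP SA.
  have [A0 dA UA] := and3P cA.
  have szA : size A = #|S| by rewrite size_tuple.
  pose idx x := find (fun B : {set 'I_n} => x \in B) A.
  have idx_lt x : idx x < size A.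
    rewrite -has_find; move: (in_setT x); rewrite -(eqP UA).
    by rewrite bigcup_seq => /bigcupP[B AB xB]; apply/hasP; exists B.
  have idx_mem x : x \in nth set0 A (idx x).
    by move: (idx_lt x); rewrite -has_find => /(nth_find set0).
  have idxP x i : i < size A -> (idx x == i) = (x \in nth set0 A i).
    move=> lt_i; apply/eqP/idP => [<-|xi]; first exact: idx_mem.
    have disj j k : j < k -> k < size A ->
        x \in nth set0 A j -> x \in nth set0 A k -> false.
      move=> jk kA xj xk; have jA := ltn_trans jk kA.
      have /pred0P/(_ x)/= := pairwiseP set0 dA j k jA kA jk.
      by rewrite xj xk.
    case: (ltngtP (idx x) i) => // h; first by have := disj _ _ h lt_i (idx_mem x) xi.
    by have := disj _ _ h (idx_lt x) xi (idx_mem x).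
  (* The block of index [i] receives the color of index [i] in [S]. The default color exists because
     [t] is positive, and is never taken since [idx x < size A = #|S|]. *)
  pose f := [ffun x => nth (Ordinal t0) (enum S) (idx x)].
  have imf : f @: setT = S.
    apply/setP => c; apply/imsetP/idP => [[x _ ->]|cS].
      by rewrite ffunE -mem_enum mem_nth // -cardE -szA.
    have lt_c : index c (enum S) < size A by rewrite szA cardE index_mem mem_enum.
    have : nth set0 A (index c (enum S)) != set0.
      by apply: contraNneq A0 => <-; apply: mem_nth.
    case/set0Pn => x; rewrite -idxP // => /eqP xi; exists x => //.
    by rewrite ffunE xi nth_index // mem_enum.
  have Ef : [seq f @^-1: [set c] | c <- enum (f @: setT)] = A.
    rewrite imf; apply: (eq_from_nth (x0 := set0)); rewrite size_map -cardE -szA //.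
    move=> i lt_i; rewrite (nth_map (Ordinal t0)) -?cardE -?szA //.
    apply/setP => x; rewrite !inE ffunE nth_uniq ?enum_uniq -?cardE -?szA //.
    exact: idxP.
  have fa : class_sizes f == a.
    by rewrite -(eqP sA) -Ef /class_sizes -map_comp.
  exists f; last by rewrite imf; congr (_, _); apply: val_inj; rewrite /= val_classes.
  rewrite !inE fa andbT; apply/forallP => c.
  have [cS|cS] := boolP (c \in f @: setT).
    by apply: (allP iA); rewrite -Ef map_f // mem_enum.
  have -> : f @^-1: [set c] = set0.
    apply/setP => x; rewrite !inE; apply: contraNF cS => /eqP <-.
    exact: imset_f.
  by rewrite /subword (eq_filter (a2 := pred0)) ?filter_pred0 // => x; rewrite inE.
(* Injectivity: with equal images and equal lists of classes, [f] and [g] have the same class at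
   each used color. *)
move=> f g; rewrite !inE => /andP[_ fa] /andP[_ ga] [Ec Ei].
have := congr1 val Ec; rewrite /= !val_classes // Ei => /eq_in_map E.
apply/ffunP => x; have := E (f x).
by rewrite -Ei mem_enum imset_f // => /(_ isT)/setP/(_ x); rewrite !inE eqxx => /esym/eqP.
Qed.

Lemma chi_nat t : 0 < t ->
  (chi alpha).[t%:R]%R = (#|colorings alpha t|)%:R%R.
Proof.
move=> t0; rewrite chiE.
under eq_bigr do rewrite binomial_polyE -natrM -card_colorings_sizes //.
rewrite -natr_sum; congr (_%:R)%R.
under eq_bigr do rewrite -sum1dep_card big_mkcondr.
(* Each coloring is counted exactly once, at its own [class_sizes], which occurs once among the
   compositions. *)
rewrite exchange_big -sum1_card; apply: eq_bigr => f _.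
rewrite -big_mkcond sum1_count.
rewrite (eq_count (a2 := pred1 (class_sizes f))); last by move=> a; rewrite /= eq_sym.
by rewrite count_uniq_mem ?uniq_compositions // mem_compositions
  composition_class_sizes.
Qed.

End Words.

Theorem theorem4p13 (n : nat) (alpha : 'S_n) :
  (forall t : nat, 0 < t ->
     (chi alpha).[t%:R]%R = (#|colorings alpha t|)%:R%R)
  /\ ((chi alpha).[-1] = (-1) ^+ n * (dcoef alpha)%:R)%R.
Proof. by split=> [t|]; [apply: chi_nat | apply: chiN1]. Qed.
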